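(* Let $\Bbbk^\bullet$ be a set of forcing commands closed under anti-$\to_\bullet$-evaluation, $\mathcal D^{\oplus\bullet}$ a positive propositional domain (for the countdown interpretation, containing all sets $\|\mathcal C[p]\|^\bullet$) and $\rho^\bullet$ a total valuation. For every MAL formula $C$, every closed term $t$ and every $p\in\mathbb N$, $$t\Vdash^\bullet(\mathbf p\Vdash_fC)\iff(t,p)\Vdash^\circ C,$$ where $\Vdash^\bullet$ is countdown-machine realizability, $\Vdash_f$ is the linear forcing translation, and $\Vdash^\circ$ is the quantitative realizability over the monoid $\mathbb N$ with the pole $\Bbbk^\circ$ and valuation $\rho^\circ$ induced by $\Bbbk^\bullet$ and $\rho^\bullet$.
   Context: **Terms.** Positive variables $x,\dots$, negative variables $\alpha,\dots$, $\kappa,\kappa'$ of either polarity. Positive values $V_+::=x\mid (V,V')\mid\{V\}\mid\overline n\ (n\in\mathbb N)\mid k_+$ (other constants); values $V::=V_+\mid t_-$; positive terms $t_+::=V_+\mid\mu\alpha.c$; negative terms $t_-::=\alpha\mid\mu(\kappa,\kappa').c\ (\kappa\neq\kappa')\mid\mu\{\kappa\}.c\mid\mu x.c\mid k_-$; commands $c::=\langle t_+|t_-\rangle$ with $\langle t|u\rangle$ and $\langle u|t\rangle$ identified. Pairs/one-tuples $(t,u)$, $\{t\}$ of non-values, should they occur, are abbreviations for $\mu\alpha.\langle t|\mu\kappa.\langle u|\mu\kappa'.\langle(\kappa,\kappa')|\alpha\rangle\rangle\rangle$, $\mu\alpha.\langle t|\mu\kappa.\langle\{\kappa\}|\alpha\rangle\rangle$.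 **Countdown machine.** A negative command is $\langle t^\ominus|u_+\rangle$ with $t$ a term of either polarity and $u_+$ a positive term ($\ominus$ is just a mark). A forcing command is a negative command $\langle t^\ominus|(u,K)\rangle$, also written $\langle t^\ominus|u\rangle\{K\}$, where $K$ is a term and $t,u$ are terms of opposite polarities; $\langle t^\ominus|u\rangle\{K\}$ and $\langle u^\ominus|t\rangle\{K\}$ are identified. For a command $c=\langle t_+|u_-\rangle$, $c^\bullet\{K\}=\langle u_-^\ominus|(t_+,K)\rangle$. Reduction $\to_\bullet$: $\langle t_-^\ominus|\mu\alpha.c\rangle\{\overline n\}\to_\bullet(c[t_-/\alpha])^\bullet\{\overline n\}$; $\langle(\mu x.c)^\ominus|V_+\rangle\{\overline n\}\to_\bullet(c[V_+/x])^\bullet\{\overline n\}$; $\langle(\mu(\kappa,\kappa').c)^\ominus|(V_1,V_2)\rangle\{\overline{n+1}\}\to_\bullet(c[V_1/\kappa,V_2/\kappa'])^\bullet\{\overline n\}$; $\langle(\mu\{\kappa\}.c)^\ominus|\{V\}\rangle\{\overline{n+1}\}\to_\bullet(c[V/\kappa])^\bullet\{\overline n\}$; the last two redexes with counter $\overline0$ diverge. Closed under anti-evaluation: $c\to_\bullet c'$ and $c'\in\Bbbk^\bullet$ imply $c\in\Bbbk^\bullet$. **Countdown interpretation.** Let $\Bbbk^\bullet_0=\{\langle t_+|u_-\rangle:\langle u_-^\ominus|t_+\rangle\in\Bbbk^\bullet\}$. Closed terms $t_+$ (positive) and $u_-$ (negative) are orthogonal if $\langle t_+|u_-\rangle\in\Bbbk^\bullet_0$;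 for a set $X$ of closed terms of one polarity, $X^\bot$ is the set of closed terms of the other polarity orthogonal to all elements of $X$. $X\otimes Y=\{(t,u):t\in X,u\in Y\}$, $\downarrow X=\{\{t\}:t\in X\}$. A positive propositional domain $\mathcal D^{\oplus\bullet}$ is a set of sets of closed positive values, closed under unions and intersections of families and such that $X\otimes Y,\downarrow X\in\mathcal D^{\oplus\bullet}$ for all $X,Y\in\mathcal D^{\oplus\bullet}\cup\{Z^\bot:Z\in\mathcal D^{\oplus\bullet}\}$; it is assumed to contain each set $\|\mathcal C[p]\|^\bullet=\{\overline n:n\in\mathbb N,\ p\le n\}$, $p\in\mathbb N$, which interprets a positive predicate constant $\mathcal C[\cdot]:\iota\to o^+$ ($\iota$ is the kind of natural numbers, $o^\pm$ the kinds of positive/negative formulas). A total valuation $\rho^\bullet$ assigns in particular to each variable $X^{\iota\to o^+}$ a function $\mathbb N\to\mathcal D^{\oplus\bullet}$. Formulas are interpreted by: $\|A\otimes B\|^\bullet=\|A\|^\bullet\otimes\|B\|^\bullet$; $\|\downarrow A\|^\bullet=\downarrow\|A\|^\bullet$; $\|\exists r.A\|^\bullet=\bigcup_{r\in\mathbb N}\|A\|^\bullet$ for $A$ positive. The equational implication $\langle T=U\rangle A$ (informally ''$T\cong U$ implies $A$'', of the same polarity as $A$) is interpreted as $A$ is if $T\cong U$ (i.e. $T$ and $U$ are convertible: they denote the same number), and by $\emptyset^\bot$ (all closed terms of the polarity of $A$) otherwise. A negative formula $N$ (built with $\wp,\uparrow,\forall$) is interpreted by orthogonality: $t\in\|N\|^\bullet$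 iff $\langle t^\ominus|u\rangle\in\Bbbk^\bullet$ for every $u\in\|N^\bot\|^\bullet$, where $t$ is a closed term that need not be negative. Realizability: $t\Vdash^\bullet A$ means $t\in\|A\|^\bullet_{\rho^\bullet}$. **MAL and forcing translation.** MAL formulas: $A,B::=P\mid N$; positive $P::=X\mid A\otimes B\mid\downarrow A$; negative $N::=X^\bot\mid A\wp B\mid\uparrow A$, with the usual De Morgan involutive negation ($\otimes/\wp$, $\downarrow/\uparrow$, $X/X^\bot$). For a predicate $Z$ on $\iota$, its forcing orthogonal is $\overline Z=\lambda r.\forall r'.\,Z(r')\multimap\mathcal C[r+r']^\bot$, with $A\multimap B=A^\bot\wp B$; thus $\|\overline Z(\mathbf p)\|^\bullet$ is the set of closed $t$ such that $\langle t^\ominus|(u,K)\rangle\in\Bbbk^\bullet$ for all $r\in\mathbb N$, $u\in\|Z(\mathbf r)\|^\bullet$, $K\in\|\mathcal C[p+r]\|^\bullet$. The translation: $X^*=X^{\iota\to o^+}$; $(X^\bot)^*=\overline{X^{\iota\to o^+}}$; $(A\otimes B)^*=\lambda r.\exists p_1.\exists p_2.\langle r=p_1+p_2\rangle(A^*(p_1)\otimes B^*(p_2))$; $(A\wp B)^*=\overline{\lambda r.\exists p_1.\exists p_2.\langle r=p_1+p_2\rangle((A^\bot)^*(p_1)\otimes(B^\bot)^*(p_2))}$; $(\downarrow A)^*=\lambda r.\downarrow A^*(r)$; $(\uparrow A)^*=\overline{\lambda r.\downarrow(A^\bot)^*(r)}$. The forcing relation is the negative formula $p\Vdash_fP\equiv\overline{\overline{P^*}}(p)$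 for $P$ positive and $p\Vdash_fN\equiv N^*(p)$ for $N$ negative. $\mathbf p$ is the numeral of $p$. **Induced quantitative realizability.** $\Bbbk^\circ=\{(c,p):c\text{ closed command},\ p\in\mathbb N,\ \forall K\in\|\mathcal C[p]\|^\bullet,\ c^\bullet\{K\}\in\Bbbk^\bullet\}$; $\rho^\circ(X)=\{(t,p):t\in\rho^\bullet(X^{\iota\to o^+})(p)\}$. A closed positive weighted term $(t_+,p)$ and a closed negative weighted term $(t_-,q)$ ($p,q\in\mathbb N$) are orthogonal if $(\langle t_+|t_-\rangle,p+q)\in\Bbbk^\circ$; for a set $X$ of positive (resp. negative) weighted terms, $X^\bot$ is the set of negative (resp. positive) weighted terms orthogonal to every element of $X$. $\|X\|^\circ=\rho^\circ(X)$; $\|X^\bot\|^\circ=\rho^\circ(X)^\bot$; $\|A\otimes B\|^\circ=\{((t,u),p+q):(t,p)\in\|A\|^\circ,(u,q)\in\|B\|^\circ\}$; $\|\downarrow A\|^\circ=\{(\{t\},p):(t,p)\in\|A\|^\circ\}$; $\|A\wp B\|^\circ=(\|A^\bot\otimes B^\bot\|^\circ)^\bot$; $\|\uparrow A\|^\circ=(\|\downarrow A^\bot\|^\circ)^\bot$. $(t,p)\Vdash^\circ C$ means $(t,p)\in\|C\|^\circ_{\rho^\circ}$.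
   Formalization: For positive C, (t,p) ⊩° C means membership in the biorthogonal of ‖C‖°; a positive ⟨T=U⟩A with T≇U is read as ∅ (∅^⊥ for negative A); realizers of a negative N must have the polarity making ⟨t^⊖|u⟩ a forcing command. Read literally, the equivalence fails. *)

(* Defs.v *)
From mathcomp Require Import all_boot.
From mathcomp Require Import classical_sets.
Set Implicit Arguments.
Unset Strict Implicit.
Unset Printing Implicit Defensive.
Local Open Scope classical_set_scope.

Inductive pol := Plus | Minus.

Definition popp (a : pol) : pol := if a is Plus then Minus else Plus.

(* Terms are well scoped: a context is the list of the polarities of the free
   variables (de Bruijn, innermost binder first), and closed means over [::]. *)
Definition ctx := seq pol.

Inductive var : ctx -> pol -> Type :=
| VZ G a : var (a :: G) a
| VS G a b : var G a -> var (b :: G) a.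

Definition scons (F : pol -> Type) G b (h : F b) (f : forall a, var G a -> F a)
    a (v : var (b :: G) a) : F a :=
  match v in var G' a' return
    match G' with
    | [::] => unit
    | b' :: G0 => F b' -> (forall a, var G0 a -> F a) -> F a'
    end with
  | VZ _ _ => fun h _ => h
  | VS _ _ _ w => fun _ f => f _ w
  end h f.

Definition ren G H := forall a, var G a -> var H a.

Definition wk b G : ren G (b :: G) := fun a v => VS b v.

Definition ren_up b G H (r : ren G H) : ren (b :: G) (b :: H) :=
  scons (F := var (b :: H)) (VZ H b) (fun a v => VS b (r a v)).

Section Calculus.

(* The types of the constants k_+ (other than the numerals) and k_-. *)
Context {Kp Kn : Type}.

(* In [mu_pair a b c] the variables kappa : a and kappa' : b are bound in c,
   kappa' being the innermost one. *)
Inductive posval (G : ctx) :=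
| pvar of var G Plus
| ppair of value G & value G
| pone of value G
| pnum of nat
| pcst of Kp
with value (G : ctx) :=
| vpos of posval G
| vneg of negtm G
with postm (G : ctx) :=
| tvalue of posval G
| mu of cmd (Minus :: G)
with negtm (G : ctx) :=
| nvar of var G Minus
| mu_pair (a b : pol) of cmd (b :: a :: G)
| mu_one (a : pol) of cmd (a :: G)
| mut of cmd (Plus :: G)
| ncst of Kn
with cmd (G : ctx) :=
| cut of postm G & negtm G.

Inductive term (G : ctx) :=
| tpos of postm G
| tneg of negtm G.

Definition tpol G (t : term G) : pol := if t is tpos _ then Plus else Minus.

Fixpoint ren_pv G H (r : ren G H) (V : posval G) : posval H :=
  match V with
  | pvar v => pvar (r _ v)
  | ppair V W => ppair (ren_v r V) (ren_v r W)
  | pone V => pone (ren_v r V)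
  | pnum n => pnum H n
  | pcst k => pcst H k
  end
with ren_v G H (r : ren G H) (V : value G) : value H :=
  match V with
  | vpos V => vpos (ren_pv r V)
  | vneg t => vneg (ren_n r t)
  end
with ren_p G H (r : ren G H) (t : postm G) : postm H :=
  match t with
  | tvalue V => tvalue (ren_pv r V)
  | mu c => mu (ren_c (ren_up r) c)
  end
with ren_n G H (r : ren G H) (t : negtm G) : negtm H :=
  match t with
  | nvar v => nvar (r _ v)
  | mu_pair a b c => mu_pair (ren_c (ren_up (ren_up r)) c)
  | mu_one a c => mu_one (ren_c (ren_up r) c)
  | mut c => mut (ren_c (ren_up r) c)
  | ncst k => ncst H k
  end
with ren_c G H (r : ren G H) (c : cmd G) : cmd H :=
  match c with
  | cut t u => cut (ren_p r t) (ren_n r u)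
  end.

Definition ren_t G H (r : ren G H) (t : term G) : term H :=
  match t with
  | tpos t => tpos (ren_p r t)
  | tneg t => tneg (ren_n r t)
  end.

(* Values of a given polarity: these are what variables stand for. *)
Definition pvalue (G : ctx) (a : pol) : Type :=
  if a is Plus then posval G else negtm G.

Definition to_value G a : pvalue G a -> value G :=
  match a with
  | Plus => fun V => vpos V
  | Minus => fun t => vneg t
  end.

Definition var_value G a : var G a -> pvalue G a :=
  match a with
  | Plus => fun v => pvar v
  | Minus => fun v => nvar v
  end.

Definition ren_pvalue G H a (r : ren G H) : pvalue G a -> pvalue H a :=
  match a with
  | Plus => fun V => ren_pv r V
  | Minus => fun t => ren_n r t
  end.

Definition subst G H := forall a, var G a -> pvalue H a.

Definition sub_up b G H (s : subst G H) : subst (b :: G) (b :: H) :=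
  scons (F := pvalue (b :: H)) (var_value (VZ H b))
    (fun a v => ren_pvalue (@wk b H) (s a v)).

Fixpoint sub_pv G H (s : subst G H) (V : posval G) : posval H :=
  match V with
  | pvar v => s _ v
  | ppair V W => ppair (sub_v s V) (sub_v s W)
  | pone V => pone (sub_v s V)
  | pnum n => pnum H n
  | pcst k => pcst H k
  end
with sub_v G H (s : subst G H) (V : value G) : value H :=
  match V with
  | vpos V => vpos (sub_pv s V)
  | vneg t => vneg (sub_n s t)
  end
with sub_p G H (s : subst G H) (t : postm G) : postm H :=
  match t with
  | tvalue V => tvalue (sub_pv s V)
  | mu c => mu (sub_c (sub_up s) c)
  end
with sub_n G H (s : subst G H) (t : negtm G) : negtm H :=
  match t with
  | nvar v => s _ v
  | mu_pair a b c => mu_pair (sub_c (sub_up (sub_up s)) c)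
  | mu_one a c => mu_one (sub_c (sub_up s) c)
  | mut c => mut (sub_c (sub_up s) c)
  | ncst k => ncst H k
  end
with sub_c G H (s : subst G H) (c : cmd G) : cmd H :=
  match c with
  | cut t u => cut (sub_p s t) (sub_n s u)
  end.

Definition sub0 G : subst G G := fun a v => var_value v.

Definition subst1 G a (c : cmd (a :: G)) (V : pvalue G a) : cmd G :=
  sub_c (scons (F := pvalue G) V (sub0 (G := G))) c.

Definition subst2 G a b (c : cmd (b :: a :: G)) (V : pvalue G a)
    (W : pvalue G b) : cmd G :=
  sub_c (scons (F := pvalue G) W (scons (F := pvalue G) V (sub0 (G := G)))) c.

Definition as_value G (t : term G) : option (value G) :=
  match t with
  | tpos (tvalue V) => Some (vpos V)
  | tpos (mu _) => None
  | tneg u => Some (vneg u)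
  end.

(* < t | mu kappa . c >, where kappa has the polarity of t. *)
Definition cut_mu G (t : term G) : cmd (tpol t :: G) -> cmd G :=
  match t with
  | tpos t => fun c => cut t (mut c)
  | tneg t => fun c => cut (mu c) t
  end.

Definition tpair_abbrev G (t u : term G) : postm G :=
  let t1 := ren_t (@wk Minus G) t in
  let u1 := ren_t (@wk (tpol t1) _) (ren_t (@wk Minus G) u) in
  let kappa' := VZ (tpol t1 :: Minus :: G) (tpol u1) in
  let kappa := VS (tpol u1) (VZ (Minus :: G) (tpol t1)) in
  let alpha := VS (tpol u1) (VS (tpol t1) (VZ G Minus)) in
  mu (cut_mu (t := t1) (cut_mu (t := u1)
    (cut (tvalue (ppair (to_value (var_value kappa))
                     (to_value (var_value kappa'))))
         (nvar alpha)))).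

Definition tpair G (t u : term G) : postm G :=
  match as_value t, as_value u with
  | Some V, Some W => tvalue (ppair V W)
  | _, _ => tpair_abbrev t u
  end.

Definition tone_abbrev G (t : term G) : postm G :=
  let t1 := ren_t (@wk Minus G) t in
  let kappa := VZ (Minus :: G) (tpol t1) in
  let alpha := VS (tpol t1) (VZ G Minus) in
  mu (cut_mu (t := t1)
    (cut (tvalue (pone (to_value (var_value kappa)))) (nvar alpha))).

Definition tone G (t : term G) : postm G :=
  if as_value t is Some V then tvalue (pone V) else tone_abbrev t.

Definition numeral G (n : nat) : term G := tpos (tvalue (pnum G n)).

(* [ncut t u] is the closed negative command < t^- | u_+ >. *)
Inductive ncmd := ncut of term [::] & postm [::].

Definition fcmd (t u K : term [::]) : ncmd := ncut t (tpair u K).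

Definition opposite G (t u : term G) : Prop := tpol t = popp (tpol u).

Definition forcing_cmd (c : ncmd) : Prop :=
  exists t u K, opposite t u /\ c = fcmd t u K.

Definition bullet (c : cmd [::]) (K : term [::]) : ncmd :=
  let: cut t u := c in fcmd (tneg u) (tpos t) K.

Inductive red : ncmd -> ncmd -> Prop :=
| red_mu t c n :
    red (fcmd (tneg t) (tpos (mu c)) (numeral _ n))
        (bullet (subst1 (a := Minus) c t) (numeral _ n))
| red_mut c V n :
    red (fcmd (tneg (mut c)) (tpos (tvalue V)) (numeral _ n))
        (bullet (subst1 (a := Plus) c V) (numeral _ n))
| red_pair a b (c : cmd [:: b; a]) (V : pvalue [::] a) (W : pvalue [::] b) n :
    red (fcmd (tneg (mu_pair c))
           (tpos (tvalue (ppair (to_value V) (to_value W)))) (numeral _ n.+1))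
        (bullet (subst2 c V W) (numeral _ n))
| red_one a (c : cmd [:: a]) (V : pvalue [::] a) n :
    red (fcmd (tneg (mu_one c))
           (tpos (tvalue (pone (to_value V)))) (numeral _ n.+1))
        (bullet (subst1 c V) (numeral _ n)).

(* A set of forcing commands modulo < t | u >{K} = < u | t >{K}, closed under
   anti-evaluation. *)
Record is_pole (k : set ncmd) : Prop := {
  pole_forcing : forall c, k c -> forcing_cmd c;
  pole_swap : forall t u K, opposite t u -> k (fcmd t u K) -> k (fcmd u t K);
  pole_antired : forall c c', red c c' -> k c' -> k c
}.

Definition tensor_set (X Y : set (term [::])) : set (postm [::]) :=
  [set v | exists t u, [/\ X t, Y u & v = tpair t u]].

Definition down_set (X : set (term [::])) : set (postm [::]) :=
  [set v | exists2 t, X t & v = tone t].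

(* || C[p] || *)
Definition cset (p : nat) : set (posval [::]) :=
  [set V | exists2 n, p <= n & V = pnum _ n].

Definition pole0 (k : set ncmd) : set (cmd [::]) :=
  [set c | let: cut t u := c in k (ncut (tneg u) t)].

Definition orth (k : set ncmd) (X : set (posval [::])) : set (negtm [::]) :=
  [set u | forall V, X V -> pole0 k (cut (tvalue V) u)].

Definition pterms (X : set (posval [::])) : set (term [::]) :=
  [set tpos (tvalue V) | V in X].

(* D together with the Z^orth for Z in D, as sets of closed terms. *)
Definition dom_ext (k : set ncmd) (D : set (set (posval [::]))) :
    set (set (term [::])) :=
  [set X | exists2 Z, D Z &
    X = pterms Z \/ X = [set @tneg [::] u | u in orth k Z]].

Record is_domain (k : set ncmd) (D : set (set (posval [::]))) : Prop := {
  dom_bigcup : forall F, F `<=` D -> D (\bigcup_(X in F) X);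
  dom_bigcap : forall F, F `<=` D -> D (\bigcap_(X in F) X);
  dom_tensor : forall X Y, dom_ext k D X -> dom_ext k D Y ->
    exists2 Z, D Z & tensor_set X Y = [set @tvalue [::] V | V in Z];
  dom_down : forall X, dom_ext k D X ->
    exists2 Z, D Z & down_set X = [set @tvalue [::] V | V in Z];
  dom_cset : forall p, D (cset p)
}.

End Calculus.

Arguments posval : clear implicits.
Arguments value : clear implicits.
Arguments postm : clear implicits.
Arguments negtm : clear implicits.
Arguments cmd : clear implicits.
Arguments term : clear implicits.
Arguments ncmd : clear implicits.

(* Expressions of kind iota; their variables are de Bruijn indices. *)
Inductive iexp :=
| ivar of nat
| inum of nat
| iadd of iexp & iexp.

Fixpoint ieval (env : seq nat) (e : iexp) : nat :=
  match e with
  | ivar i => nth 0 env i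
  | inum n => n
  | iadd e1 e2 => ieval env e1 + ieval env e2
  end.

Fixpoint ilift (e : iexp) : iexp :=
  match e with
  | ivar i => ivar i.+1
  | inum n => inum n
  | iadd e1 e2 => iadd (ilift e1) (ilift e2)
  end.

(* A negative formula is the formal De Morgan dual of a positive one, so that
   negation is involutive by construction; X^orth, C[e]^orth, par, up, forall
   and the negative equational implication are the [fdual] of X, C[e], tensor,
   down, exists and the positive equational implication.  Variables of kind
   iota -> o+ are named by natural numbers; [fex] binds index 0. *)
Inductive form :=
| fpos of pform
| fneg of nform
with nform :=
| fdual of pform
with pform :=
| fatom of nat & iexp
| fcst of iexp
| ftensor of form & form
| fdown of form
| fex of pform
| feq of iexp & iexp & pform.

Definition fnot (A : form) : form :=
  match A with
  | fpos P => fneg (fdual P)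
  | fneg (fdual P) => fpos P
  end.

Definition fpar (A B : form) : nform := fdual (ftensor (fnot A) (fnot B)).
Definition fall (N : nform) : nform := let: fdual P := N in fdual (fex P).
Definition flolli (A B : form) : nform := fpar (fnot A) B.

(* The forcing orthogonal of Z, applied to e.  A predicate on iota is given by
   its instances; those to which [fbar] is applied below are closed, so that
   nothing is captured by the quantifier. *)
Definition fbar (Z : iexp -> form) (e : iexp) : nform :=
  fall (flolli (Z (ivar 0))
    (fneg (fdual (fcst (iadd (ilift e) (ivar 0)))))).

(* The polarity of the realizers of a formula.  Terms of either polarity may
   realize a negative formula, but < t | (u, K) > is a forcing command only if
   t and u have opposite polarities. *)
Fixpoint fpol (A : form) : pol :=
  match A with
  | fpos _ => Plus
  | fneg N => npol N
  end
with npol (N : nform) : pol :=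
  match N with
  | fdual P => cpol P
  end
with cpol (P : pform) : pol :=
  match P with
  | ftensor A _ => popp (fpol A)
  | fex P | feq _ _ P => cpol P
  | fatom _ _ | fcst _ | fdown _ => Minus
  end.

Section Countdown.
Context {Kp Kn : Type}.
Variables (k : set (ncmd Kp Kn)) (rho : nat -> nat -> set (posval Kp Kn [::])).

(* The equational implication from a false equation is the empty set for a
   positive formula and, dually, the orthogonal of the empty set for a negative
   one. *)
Fixpoint interp (env : seq nat) (A : form) : set (term Kp Kn [::]) :=
  match A with
  | fpos P => [set tpos t | t in pinterp env P]
  | fneg N => ninterp env N
  end
with ninterp (env : seq nat) (N : nform) : set (term Kp Kn [::]) :=
  match N with
  | fdual P => [set t | tpol t = cpol P /\
                        forall u, pinterp env P u -> k (ncut t u)]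
  end
with pinterp (env : seq nat) (P : pform) : set (postm Kp Kn [::]) :=
  match P with
  | fatom X e => [set tvalue V | V in rho X (ieval env e)]
  | fcst e => [set tvalue V | V in cset (ieval env e)]
  | ftensor A B => tensor_set (interp env A) (interp env B)
  | fdown A => down_set (interp env A)
  | fex P => \bigcup_r pinterp (r :: env) P
  | feq e1 e2 P => [set t | ieval env e1 = ieval env e2 /\ pinterp env P t]
  end.

Definition creal (t : term Kp Kn [::]) (A : form) : Prop := interp [::] A t.

End Countdown.

(* Negative formulas are again formal duals. *)
Inductive mal :=
| mpos of mpform
| mneg of mnform
with mnform :=
| mdual of mpform
with mpform :=
| mvar of nat
| mtensor of mal & mal
| mdown of mal.

Definition mnot (A : mal) : mal :=
  match A with
  | mpos P => mneg (mdual P)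
  | mneg (mdual P) => mpos P
  end.

Definition mpar (A B : mal) : mnform := mdual (mtensor (mnot A) (mnot B)).
Definition mup (A : mal) : mnform := mdual (mdown (mnot A)).

Fixpoint star (A : mal) (r : iexp) : form :=
  match A with
  | mpos P => fpos (pstar P r)
  | mneg N => fneg (nstar N r)
  end
with nstar (N : mnform) (r : iexp) : nform :=
  match N with
  | mdual P => fbar (fun r => fpos (pstar P r)) r
  end
with pstar (P : mpform) (r : iexp) : pform :=
  match P with
  | mvar X => fatom X r
  | mtensor A B =>
      fex (fex (feq (ilift (ilift r)) (iadd (ivar 1) (ivar 0))
        (ftensor (star A (ivar 1)) (star B (ivar 0)))))
  | mdown A => fdown (star A r)
  end.

Lemma nstar_var X r :
  nstar (mdual (mvar X)) r = fbar (fun r => fpos (fatom X r)) r.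
Proof. by []. Qed.

Lemma nstar_par A B r :
  nstar (mpar A B) r =
  fbar (fun r => fpos (fex (fex (feq (ilift (ilift r)) (iadd (ivar 1) (ivar 0))
    (ftensor (star (mnot A) (ivar 1)) (star (mnot B) (ivar 0))))))) r.
Proof. by []. Qed.

Lemma nstar_up A r :
  nstar (mup A) r = fbar (fun r => fpos (fdown (star (mnot A) r))) r.
Proof. by []. Qed.

Definition forces (p : iexp) (C : mal) : nform :=
  match C with
  | mpos P => fbar (fun r => fneg (fbar (fun r => fpos (pstar P r)) r)) p
  | mneg N => nstar N p
  end.

Section Quantitative.
Context {Kp Kn : Type}.
Variables (k : set (cmd Kp Kn [::] * nat))
          (rho : nat -> set (postm Kp Kn [::] * nat)).

Definition worth (t : postm Kp Kn [::] * nat) (u : negtm Kp Kn [::] * nat) :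
    Prop :=
  k (cut t.1 u.1, t.2 + u.2).

Definition worthp (X : set (postm Kp Kn [::] * nat)) :
    set (negtm Kp Kn [::] * nat) :=
  [set u | forall t, X t -> worth t u].

Definition worthn (X : set (negtm Kp Kn [::] * nat)) :
    set (postm Kp Kn [::] * nat) :=
  [set t | forall u, X u -> worth t u].

Definition wpos (X : set (postm Kp Kn [::] * nat)) :
    set (term Kp Kn [::] * nat) :=
  [set (tpos t.1, t.2) | t in X].

Definition wneg (X : set (negtm Kp Kn [::] * nat)) :
    set (term Kp Kn [::] * nat) :=
  [set (tneg t.1, t.2) | t in X].

Fixpoint qinterp (A : mal) : set (term Kp Kn [::] * nat) :=
  match A with
  | mpos P => wpos (qpinterp P)
  | mneg N => wneg (qninterp N)
  end
with qninterp (N : mnform) : set (negtm Kp Kn [::] * nat) :=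
  match N with
  | mdual P => worthp (qpinterp P)
  end
with qpinterp (P : mpform) : set (postm Kp Kn [::] * nat) :=
  match P with
  | mvar X => rho X
  | mtensor A B =>
      [set v | exists t u p q,
        [/\ qinterp A (t, p), qinterp B (u, q) & v = (tpair t u, p + q)]]
  | mdown A =>
      [set v | exists t p, qinterp A (t, p) /\ v = (tone t, p)]
  end.

(* As for the countdown machine, where the realizers of p ||- P are the double
   forcing orthogonal of P*, a positive formula is realized by the weighted
   terms in the biorthogonal of its set of weighted values. *)
Definition qreal (t : term Kp Kn [::] * nat) (C : mal) : Prop :=
  match C with
  | mpos P => wpos (worthn (worthp (qpinterp P))) t
  | mneg N => wneg (qninterp N) t
  end.

End Quantitative.

Definition induced_pole (Kp Kn : Type) (k : set (ncmd Kp Kn)) :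
    set (cmd Kp Kn [::] * nat) :=
  [set cp | forall V, cset cp.2 V -> k (bullet cp.1 (tpos (tvalue V)))].

Definition induced_val (Kp Kn : Type)
    (rho : nat -> nat -> set (posval Kp Kn [::])) (X : nat) :
    set (postm Kp Kn [::] * nat) :=
  [set tp | exists2 V, rho X tp.2 V & tp.1 = tvalue V].

(* Main.v *)
(* Evaluating the quantifiers and equations of the forcing translation turns
   each forcing orthogonal into a quantitative orthogonal for the induced pole,
   the weight of a term being the index at which its forcing predicate is
   evaluated.  A positive formula has a second orthogonal, whose realizers are
   positive; there the identification of <t|u>{K} with <u|t>{K} puts the command
   back in the form c{K} to which the induced pole refers. *)
Require Import Defs.
From mathcomp Require Import all_boot.
From mathcomp Require Import classical_sets.

Lemma ieval_ilift r env e : ieval (r :: env) (ilift e) = ieval env e.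
Proof. by elim: e => //= e1 -> e2 ->. Qed.

Scheme mal_mutind := Induction for mal Sort Prop
with mnform_mutind := Induction for mnform Sort Prop
with mpform_mutind := Induction for mpform Sort Prop.

Section Forcing.
Context {Kp Kn : Type}.
Variables (k : set (ncmd Kp Kn)) (rho : nat -> nat -> set (posval Kp Kn [::])).

Notation qi := (qinterp (induced_pole k) (induced_val rho)).
Notation qpi := (qpinterp (induced_pole k) (induced_val rho)).

(** The dual of [fbar] is an existential over tensors whose second component is a numeral at least
    the sum of the two indices; a positive first component makes the realizers negative. *)
Lemma ninterp_fbarpos (Z : iexp -> pform) env e t :
  ninterp k rho env (fbar (fun r => fpos (Z r)) e) t <->
  tpol t = Minus /\
  forall r u n, pinterp k rho (r :: env) (Z (ivar 0)) u ->
    ieval env e + r <= n -> k (fcmd t (tpos u) (numeral _ n)).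
Proof.
split=> -[tpolE tZ]; split=> //; last first.
  move=> v [r _ [u' [K [[u Zu <-]]]]].
  case=> _ [_ [n /= le_n ->] <-] <- ->.
  by apply: (tZ r) => //; rewrite -(ieval_ilift r).
move=> r u n Zu le_n.
apply: tZ; exists r => //; exists (tpos u), (numeral _ n); split=> //.
  by exists u.
exists (tvalue (pnum _ n)) => //; exists (pnum _ n) => //.
by exists n => //=; rewrite ieval_ilift.
Qed.

(** The polarity hypothesis makes the realizers [u] of the inner predicate negative, hence those of
    its orthogonal positive. *)
Lemma ninterp_fbarneg (Z : iexp -> pform) env e t :
  cpol (Z (ivar 0)) = Minus ->
  ninterp k rho env (fbar (fun r => fneg (fdual (Z r))) e) t <->
  tpol t = Plus /\
  forall r u n, ninterp k rho (r :: env) (fdual (Z (ivar 0))) u ->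
    ieval env e + r <= n -> k (fcmd t u (numeral _ n)).
Proof.
move=> /= polZ; rewrite polZ.
split=> -[tpolE tZ]; split=> //; last first.
  move=> v [r _ [u [K [Zu]]]].
  case=> _ [_ [n /= le_n ->] <-] <- ->.
  by apply: (tZ r u n) => //; rewrite -(ieval_ilift r).
move=> r u n Zu le_n.
apply: tZ; exists r => //; exists u, (numeral _ n); split=> //=.
exists (tvalue (pnum _ n)) => //; exists (pnum _ n) => //.
by exists n => //=; rewrite ieval_ilift.
Qed.

Lemma induced_poleE t u p :
  induced_pole k (cut t u, p) <->
  forall n, p <= n -> k (fcmd (tneg u) (tpos t) (numeral _ n)).
Proof.
split=> [ktu n le_n|ktu _ [n le_n ->]]; last exact: ktu.
by apply: (ktu (pnum _ n)); exists n.
Qed.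

(** The index [r] quantified by [fbar] becomes the weight of the positive opponent, and the polarity
    clause becomes membership in the image [wneg]. *)
Lemma ninterp_fbar_worthp P env e t :
    (forall env e u, pinterp k rho env (pstar P e) u <->
                     qpi P (u, ieval env e)) ->
  ninterp k rho env (fbar (fun r => fpos (pstar P r)) e) t <->
  wneg (worthp (induced_pole k) (qpi P)) (t, ieval env e).
Proof.
move=> IH; split=> [/(ninterp_fbarpos (pstar P))[]|].
  case: t => // t _ tP; exists (t, ieval env e) => // -[u r] Pu.
  (* [worth] adds the positive weight first, [fbar] its argument [e] first. *)
  apply/induced_poleE => n /=; rewrite addnC; apply: tP.
  by apply/(IH (r :: env) (ivar 0)).
case=> -[{}t p] tP [<- epE]; apply/(ninterp_fbarpos (pstar P)); split=> // r u n.
move=> /(IH (r :: env) (ivar 0))/tP/induced_poleE tu.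
by rewrite addnC -epE => /tu.
Qed.

(** Mutual induction on MAL formulas, with [env] general because the translation puts subformulas
    under its own binders. *)
Lemma pstar_qpinterp P env e u :
  pinterp k rho env (pstar P e) u <-> qpi P (u, ieval env e).
Proof.
move: P env e u.
apply: (mpform_mutind
  (fun A => forall env e t,
     interp k rho env (star A e) t <-> qi A (t, ieval env e))
  (fun N => forall env e t,
     ninterp k rho env (nstar N e) t <->
     wneg (qninterp (induced_pole k) (induced_val rho) N) (t, ieval env e))) =>
  [P IH|N IH|P IH|X|A IHA B IHB|A IHA] env e.
- move=> t; split=> [[u /IH Pu <-]|[[u p] /= Pu [<- ep]]].
    by exists (u, ieval env e).
  by exists u => //; apply/IH; rewrite -ep.
- exact: IH.
- by move=> t; apply: ninterp_fbar_worthp.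
- by move=> u; split=> -[V XV /= uV]; exists V.
- move=> v; split.
    (* The equation guarding the tensor says that the two component weights [p] and [q] add up to
       the total weight. *)
    case=> p _ [q _ [/=]]; rewrite !ieval_ilift => epq.
    move=> [t [u [/IHA tA /IHB uB ->]]].
    by exists t, u, p, q; rewrite epq.
  case=> t [u [p [q [tA uB [-> epq]]]]].
  exists p => //; exists q => //; split; first by rewrite /= !ieval_ilift.
  by exists t, u; split=> //; [apply/IHA | apply/IHB].
- move=> v; split=> [[t /IHA tA ->]|[t [p [tA [-> ep]]]]].
    by exists t, (ieval env e).
  by exists t => //; apply/IHA; rewrite ep.
Qed.

End Forcing.

Theorem theorem90 (Kp Kn : Type) (k : set (ncmd Kp Kn))
    (D : set (set (posval Kp Kn [::])))
    (rho : nat -> nat -> set (posval Kp Kn [::]))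
    (hk : is_pole k) (hD : is_domain k D) (hrho : forall X r, D (rho X r))
    (C : mal) (t : term Kp Kn [::]) (p : nat) :
  creal k rho t (fneg (forces (inum p) C)) <->
  qreal (induced_pole k) (induced_val rho) (t, p) C.
Proof.
have nstarP P env e u : ninterp k rho env (nstar (mdual P) e) u <->
    wneg (worthp (induced_pole k) (qpinterp (induced_pole k) (induced_val rho) P))
      (u, ieval env e).
  by apply: ninterp_fbar_worthp => *; apply: pstar_qpinterp.
case: C => [P|[P]]; last exact: (nstarP P [::] (inum p)).
(* The inner orthogonal computes to an [fdual]; stripping it gives the positive predicate that
   [ninterp_fbarneg] expects. *)
have biorthP := ninterp_fbarneg k rho
  (fun r => let: fdual Q := nstar (mdual P) r in Q) [::] (inum p).
split=> [/biorthP[]//|].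
  case: t => // t _ tP; exists (t, p) => // -[u r] Pu.
  apply/induced_poleE => n /= le_n; apply: (pole_swap hk) => //.
  by apply: (tP r) => //; apply/(nstarP P [:: r] (ivar 0)); exists (u, r).
case=> -[{}t q] tP [<- epq]; apply/biorthP => //; split=> // r v n.
move=> /(nstarP P [:: r] (ivar 0))[[u s] /tP/induced_poleE tu [<- esr]].
rewrite /= -epq -[r]esr => /tu; exact: (pole_swap hk).
Qed.
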